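(* Let $F_2$ be the free group on $\gamma_1,\gamma_2$, and let $t_1,t_2,t_{12}$ be the trace functions of $\gamma_1,\gamma_2,\gamma_1\gamma_2$. The volume form on $\mathcal R^*(F_2,\mathrm{SL}_2(\mathbb C))$ is $$\Omega_{F_2}=\pm2\sqrt2\;dt_1\wedge dt_2\wedge dt_{12}.$$
   Context: The trace function of $\gamma$ is $[\rho]\mapsto\operatorname{tr}\rho(\gamma)$. A representation $\rho\colon F_2\to\mathrm{SL}_2(\mathbb C)$ is good if its image is contained in no proper parabolic subgroup (i.e. it is irreducible) and its centralizer is the center of $\mathrm{SL}_2(\mathbb C)$. $\mathcal R^*(F_2,\mathrm{SL}_2(\mathbb C))$ is the set of conjugacy classes of good representations, a complex manifold of dimension $3$ with $T_{[\rho]}\mathcal R^*(F_2,\mathrm{SL}_2(\mathbb C))\cong H^1(F_2;\operatorname{Ad}\rho)$ (the path $\rho_s$ corresponds to the class of the cocycle $\gamma\mapsto\frac{d}{ds}\rho_s(\gamma)\rho(\gamma)^{-1}|_{s=0}$). Volume form $\Omega_{F_2}$ (Reidemeister torsion, defined up to sign): let $\mathcal B(X,Y)=-\operatorname{tr}(XY)$ on $\mathfrak g=\mathfrak{sl}_2(\mathbb C)$. Let $C^0=\mathfrak g$, $C^1=\mathfrak g^2$, $\delta(X)=(\operatorname{Ad}_{\rho(\gamma_i)}X-X)_{i=1}^2$, so that $H^1(F_2;\operatorname{Ad}\rho)=C^1/\operatorname{Im}\delta$. Let $\mathbf c^0$ be a $\mathcal B$-orthonormal basis of $\mathfrak g$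 and $\mathbf c^1$ the corresponding basis of $\mathfrak g^2$. For a basis $\mathbf h$ of $H^1(F_2;\operatorname{Ad}\rho)$ with representatives $\widetilde{\mathbf h}\subset C^1$, $\Omega_{F_2}(\wedge\mathbf h)=\pm[\delta\mathbf c^0\sqcup\widetilde{\mathbf h}:\mathbf c^1]$, where $[\mathbf a:\mathbf b]$ is the determinant of the matrix expressing $\mathbf a$ in terms of $\mathbf b$ and $\wedge\mathbf h$ is the exterior product of the elements of $\mathbf h$. *)

(* Defs.v *)
From HB Require Import structures.
From mathcomp Require Import all_boot all_order all_algebra.
From mathcomp Require Import all_classical all_reals all_analysis.
From mathcomp Require Export complex.

Set Implicit Arguments.
Unset Strict Implicit.
Unset Printing Implicit Defensive.

Import Order.TTheory GRing.Theory Num.Theory.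
Import numFieldNormedType.Exports.

Local Open Scope classical_set_scope.
Local Open Scope ring_scope.
Local Open Scope complex_scope.

Definition free_on2 (F : groupType) (g1 g2 : F) : Prop :=
  forall G : groupType,
    (forall a b : G, exists f : {multiplicative F -> G}, f g1 = a /\ f g2 = b) /\
    (forall f f' : {multiplicative F -> G},
        f g1 = f' g1 -> f g2 = f' g2 -> f =1 f').

Record SL2 (K : fieldType) := MkSL2 {
  slmx : 'M[K]_2;
  _ : \det slmx == 1 }.

HB.instance Definition _ (K : fieldType) := [isSub of SL2 K for @slmx K].
HB.instance Definition _ (K : fieldType) := [Choice of SL2 K by <:].

Section SL2Group.
Variable K : fieldType.
Implicit Types A B : SL2 K.

Lemma SL2_det A : \det (slmx A) = 1.
Proof. by case: A => A /= /eqP. Qed.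

Lemma SL2_unit A : slmx A \in unitmx.
Proof. by rewrite unitmxE SL2_det unitr1. Qed.

Fact SL2_one_subproof : \det (1%:M : 'M[K]_2) == 1.
Proof. by rewrite det1. Qed.

Fact SL2_mul_subproof A B : \det (slmx A *m slmx B) == 1.
Proof. by rewrite det_mulmx !SL2_det mulr1. Qed.

Fact SL2_inv_subproof A : \det (invmx (slmx A)) == 1.
Proof. by rewrite det_inv SL2_det invr1. Qed.

Definition SL2_one := MkSL2 SL2_one_subproof.
Definition SL2_mul A B := MkSL2 (SL2_mul_subproof A B).
Definition SL2_inv A := MkSL2 (SL2_inv_subproof A).

Fact SL2_mulA : associative SL2_mul.
Proof. by move=> A B D; apply: val_inj; rewrite /= mulmxA. Qed.
Fact SL2_mul1 : left_id SL2_one SL2_mul.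
Proof. by move=> A; apply: val_inj; rewrite /= mul1mx. Qed.
Fact SL2_1mul : right_id SL2_one SL2_mul.
Proof. by move=> A; apply: val_inj; rewrite /= mulmx1. Qed.
Fact SL2_mulV : left_inverse SL2_one SL2_inv SL2_mul.
Proof. by move=> A; apply: val_inj; rewrite /= mulVmx ?SL2_unit. Qed.
Fact SL2_Vmul : right_inverse SL2_one SL2_inv SL2_mul.
Proof. by move=> A; apply: val_inj; rewrite /= mulmxV ?SL2_unit. Qed.

End SL2Group.

HB.instance Definition _ (K : fieldType) :=
  isGroup.Build (SL2 K) (@SL2_mulA K) (@SL2_mul1 K) (@SL2_1mul K)
    (@SL2_mulV K) (@SL2_Vmul K).

Definition sl2 (K : fieldType) : {vspace 'M[K]_2} :=
  lker (linfun (fun A : 'M[K]_2 => \tr A : K^o)).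

Lemma mem_sl2 (K : fieldType) (A : 'M[K]_2) : (A \in sl2 K) = (\tr A == 0).
Proof. by rewrite memv_ker lfunE. Qed.

Section Torsion.
Variable K : fieldType.
Local Notation g := (subvs_of (sl2 K)).

Fact Ad_subproof (A : SL2 K) (X : g) : slmx A *m vsval X *m invmx (slmx A) \in sl2 K.
Proof.
rewrite mem_sl2 mxtrace_mulC mulmxA mulVmx ?SL2_unit // mul1mx.
by rewrite -mem_sl2 subvsP.
Qed.

Definition Ad (A : SL2 K) (X : g) : g := Subvs (Ad_subproof A X).

Definition formB (X Y : g) : K := - \tr (vsval X *m vsval Y).

Definition orthonormal_basis (c : 3.-tuple g) : Prop :=
  basis_of fullv c /\
  forall i j : 'I_3, formB (tnth c i) (tnth c j) = (i == j)%:R.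

(* The determinant of the matrix expressing [a] in terms of the basis [b]. *)
Definition basis_change (V : vectType K) (n : nat) (a b : n.-tuple V) : K :=
  \det (\matrix_(i < n, j < n) coord b j (tnth a i)).

Definition double_basis (c : 3.-tuple g) : (3 + 3).-tuple (g * g)%type :=
  [tuple of [seq (X, 0) | X <- c] ++ [seq (0, X) | X <- c]].

End Torsion.

Section Representations.
Variables (K : fieldType) (F : groupType) (g1 g2 : F).
Local Notation g := (subvs_of (sl2 K)).
Local Notation rep := {multiplicative F -> SL2 K}.

(* The proper parabolic subgroups of SL_2 are the stabilizers of the lines
   of K^2, i.e. the sets [parabolic v] with [v != 0]. *)
Definition parabolic (v : 'cV[K]_2) : set (SL2 K) :=
  [set A : SL2 K | exists a : K, slmx A *m v = a *: v].

Definition irreducible_rep (rho : rep) : Prop :=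
  ~ exists2 v : 'cV[K]_2, v != 0 & range rho `<=` parabolic v.

Definition centralizer_rep (rho : rep) : set (SL2 K) :=
  [set A | forall x : F, commute A (rho x)].

Definition center_SL2 : set (SL2 K) :=
  [set A | forall B : SL2 K, commute A B].

Definition good (rho : rep) : Prop :=
  irreducible_rep rho /\ centralizer_rep rho = center_SL2.

Definition trace_fun (x : F) (rho : rep) : K := \tr (slmx (rho x)).

(* A 1-cocycle of the free group on [g1], [g2] is identified with the pair of
   its values at [g1] and [g2]; the space of cocycles thus becomes C^1 = g * g,
   and H^1 = C^1 / Im delta. *)
Definition delta (rho : rep) (X : g) : g * g :=
  (Ad (rho g1) X - X, Ad (rho g2) X - X).

Definition cohomologous (rho : rep) (z w : g * g) : Prop :=
  exists X : g, z - w = delta rho X.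

(* The classes of the [h_i] form a basis of C^1 / Im delta. *)
Definition H1_basis (rho : rep) (h : 3.-tuple (g * g)%type) : Prop :=
  forall z : g * g, exists! a : 'rV[K]_3,
    cohomologous rho z (\sum_(i < 3) a 0 i *: tnth h i).

Definition Omega (c0 : 3.-tuple g) (rho : rep) (h : 3.-tuple (g * g)%type) : K :=
  basis_change [tuple of map (delta rho) c0 ++ h] (double_basis c0).

End Representations.

Definition wedge3 (K : fieldType) (V : Type) (a1 a2 a3 : V -> K)
    (h : 3.-tuple V) : K :=
  \det (\matrix_(i < 3, j < 3) tnth [tuple a1; a2; a3] i (tnth h j)).

Section Differential.
Variables (R : realType) (F : groupType) (g1 g2 : F).
Local Notation C := R[i].
Local Notation g := (subvs_of (sl2 C)).
Local Notation rep := {multiplicative F -> SL2 C}.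

Definition derive_at0 (f : R -> C) (v : C) : Prop :=
  is_derive (0 : R) (1 : R) (fun s => complex.Re (f s)) (complex.Re v) /\
  is_derive (0 : R) (1 : R) (fun s => complex.Im (f s)) (complex.Im v).

Definition mxderive_at0 (f : R -> 'M[C]_2) (D : 'M[C]_2) : Prop :=
  forall i j, derive_at0 (fun s => f s i j) (D i j).

(* [rho_] is a path of good representations through [rho], and [z] is the
   cocycle x |-> d/ds rho_s(x) rho(x)^-1 at s = 0. *)
Definition path_with_tangent (rho : rep) (rho_ : R -> rep) (z : g * g) : Prop :=
  [/\ rho_ 0 =1 rho,
      \forall s \near (0 : R), good (rho_ s),
      mxderive_at0 (fun s => slmx (rho_ s g1 * (rho g1)^-1)%g) (vsval z.1) &
      mxderive_at0 (fun s => slmx (rho_ s g2 * (rho g2)^-1)%g) (vsval z.2)].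

(* The value at the class of [z], viewed as a tangent vector at [rho], of the
   differential of [f]: the derivative of [f] along any path of good
   representations whose tangent cocycle is cohomologous to [z] (with value 0
   if there were no such derivative). *)
Definition diff_at (f : rep -> C) (rho : rep) (z : g * g) : C :=
  xget 0 [set v : C | exists (rho_ : R -> rep) (w : g * g),
    [/\ path_with_tangent rho rho_ w, cohomologous g1 g2 rho w z &
        derive_at0 (f \o rho_) v]].

End Differential.

(* Main.v *)
(** Both sides are alternating 3-forms in cocycles [h], killed by coboundaries.
    Write [A], [B] for the images of the generators and pair a cocycle [z] with
    a pair of matrices [(U, W)] by [tr (z_1 U) + tr (z_2 W)].  Since the path
    [rho_s] moves [A] to [(1 + s z_1) A] at first order, the differentials of the
    three traces are the pairings with [(A, 0)], [(0, B)] and [(AB, BA)]; they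
    vanish on [Im delta].  Complete them by the pairings with [(B, 0)], [(AB, 0)],
    [(0, A)], and evaluate the six functionals on [delta c0 ++ h]: the resulting
    matrix is block triangular, and it is also the matrix defining [Omega] times
    the matrix of the functionals on the basis of [C^1].  With
    [k = det (AB - BA)] and [v] the volume of [c0] in the matrix coordinates,
    this reads
      [Omega(h) * (k^2 v^2) = (-2 k^2 v) * (dt_1 /\ dt_2 /\ dt_12)(h)],
    where [2 v^2 = 1] by orthonormality.  Finally [k <> 0] exactly when [A] and
    [B] have no common eigenvector, an open condition equivalent to [rho] being
    good; hence every cocycle is tangent to a path of good representations. *)

From HB Require Import structures.
Require Import Defs.
From mathcomp Require Import all_boot all_order all_algebra.
From mathcomp Require Import all_classical all_reals all_analysis.
From mathcomp Require Import all_fingroup.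
From mathcomp Require Import ring.

Set Implicit Arguments.
Unset Strict Implicit.
Unset Printing Implicit Defensive.

Import Order.TTheory GRing.Theory Num.Theory.
Import numFieldNormedType.Exports.

Local Open Scope classical_set_scope.
Local Open Scope ring_scope.
Local Open Scope complex_scope.

(** * Entrywise formulas for matrices of size 2 and 3 *)

Lemma forall_ord2 (P : 'I_2 -> Prop) : P 0 -> P 1 -> forall i, P i.
Proof.
move=> P0 P1 [[|[|//]] lti].
- by have -> : Ordinal lti = 0 by apply: val_inj.
- by have -> : Ordinal lti = 1 by apply: val_inj.
Qed.

Lemma sum_ord2 (V : nmodType) (f : 'I_2 -> V) : \sum_i f i = f 0 + f 1.
Proof. by rewrite big_ord_recl big_ord1; congr (_ + f _); apply: val_inj. Qed.

Lemma sum_ord3 (V : nmodType) (f : 'I_3 -> V) : \sum_i f i = f 0 + f 1 + f 2.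
Proof.
rewrite !big_ord_recl big_ord0 addr0 addrA.
by congr (_ + f _ + f _); apply: val_inj.
Qed.

Section Matrix2.
Variable K : comPzRingType.
Implicit Types X : 'M[K]_2.

Lemma mulmx2E m n (X : 'M[K]_(m, 2)) (Y : 'M[K]_(2, n)) i j :
  (X *m Y) i j = X i 0 * Y 0 j + X i 1 * Y 1 j.
Proof. by rewrite mxE sum_ord2. Qed.

Lemma mxtrace2 X : \tr X = X 0 0 + X 1 1.
Proof. by rewrite /mxtrace sum_ord2. Qed.

Lemma det2 X : \det X = X 0 0 * X 1 1 - X 0 1 * X 1 0.
Proof.
rewrite (expand_det_row _ 0) sum_ord2 /cofactor !det_mx11 !mxE.
rewrite addn0 expr0 mul1r expr1 mulN1r mulrN.
by congr (X _ _ * X _ _ - X _ _ * X _ _); apply: val_inj.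
Qed.

Lemma det3 (M : 'M[K]_3) :
  \det M = M 0 0 * (M 1 1 * M 2 2 - M 1 2 * M 2 1)
         - M 0 1 * (M 1 0 * M 2 2 - M 1 2 * M 2 0)
         + M 0 2 * (M 1 0 * M 2 1 - M 1 1 * M 2 0).
Proof.
rewrite (expand_det_row _ 0) sum_ord3 /cofactor !det2 !mxE.
have l00 : lift 0 0 = 1 :> 'I_3 by apply: val_inj.
have l01 : lift 0 1 = 2 :> 'I_3 by apply: val_inj.
have l10 : lift 1 0 = 0 :> 'I_3 by apply: val_inj.
have l11 : lift 1 1 = 2 :> 'I_3 by apply: val_inj.
have l20 : lift 2 0 = 0 :> 'I_3 by apply: val_inj.
have l21 : lift 2 1 = 1 :> 'I_3 by apply: val_inj.
by rewrite l00 l01 l10 l11 l20 l21 /=; ring.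
Qed.

Lemma sqmx2 X : X *m X = \tr X *: X - (\det X)%:M.
Proof.
rewrite mxtrace2 det2; apply/matrixP=> i j; rewrite mulmx2E !mxE.
by elim/forall_ord2: i; elim/forall_ord2: j; rewrite /=; ring.
Qed.

(** For [A] and [B] of determinant 1 this is 2 minus the trace of their group commutator. *)
Definition comm_det (A B : 'M[K]_2) := \det (A *m B - B *m A).

End Matrix2.

(* Cayley-Hamilton; it makes the inverse polynomial in the entries. *)
Lemma invmx_SL2 (K : fieldType) (A : SL2 K) :
  invmx (slmx A) = (\tr (slmx A))%:M - slmx A.
Proof.
apply: (can_inj (mulKmx (SL2_unit A))).
rewrite mulmxV ?SL2_unit// mulmxBr mul_mx_scalar sqmx2 SL2_det.
by rewrite opprB addrC subrK.
Qed.

(** * Irreducibility and commutators *)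

Section SubgroupType.
Variables (F : groupType) (S : {pred F}) (closedS : group_closed S).

Definition subgroup_type of group_closed S := {y : F | y \in S}.

HB.instance Definition _ := [isSub of subgroup_type closedS for @sval F _].
HB.instance Definition _ := [Choice of subgroup_type closedS by <:].
HB.instance Definition _ :=
  SubChoice_isSubGroup.Build F S (subgroup_type closedS) closedS.

(** The homomorphism from [F] to the subgroup [S] fixing both generators, followed by the inclusion,
    agrees with the identity on [g1] and [g2], hence everywhere by uniqueness. *)
Lemma free_on2_ind (g1 g2 : F) :
  free_on2 g1 g2 -> g1 \in S -> g2 \in S -> forall x, x \in S.
Proof.
move=> freeF S1 S2 x; pose T : groupType := subgroup_type closedS.
have [/(_ (Sub g1 S1 : T) (Sub g2 S2 : T)) [f [f1 f2]] _] := freeF T.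
have [_ uniqF] := freeF F.
suff <- : val (f x) = x by apply: valP.
by apply: (uniqF (val \o f) idfun) => /=; rewrite ?f1 ?f2 SubK.
Qed.

End SubgroupType.

Section RepresentationMatrices.
Variables (K : fieldType) (F : groupType) (rho : {multiplicative F -> SL2 K}).

Lemma slmx_repM x y : slmx (rho (x * y)%g) = slmx (rho x) *m slmx (rho y).
Proof. by rewrite gmulfM. Qed.

Lemma slmx_rep1 : slmx (rho 1%g) = 1%:M.
Proof.
apply: (can_inj (mulKmx (SL2_unit (rho 1%g)))).
by rewrite -slmx_repM mulg1 mulmx1.
Qed.

Lemma slmx_repV x : slmx (rho x^-1%g) = invmx (slmx (rho x)).
Proof.
apply: (can_inj (mulKmx (SL2_unit (rho x)))).
by rewrite -slmx_repM mulgV slmx_rep1 mulmxV ?SL2_unit.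
Qed.

End RepresentationMatrices.

Section CommutingMatrices.
Variable K : fieldType.
Implicit Types (A B M : 'M[K]_2) (v w : 'cV[K]_2).

Lemma parallel2 v w :
  v != 0 -> v 0 0 * w 1 0 = v 1 0 * w 0 0 -> exists a, w = a *: v.
Proof.
move=> v0 vw; have [v00|v00] := eqVneq (v 0 0) 0.
- have v10 : v 1 0 != 0.
    apply: contra_neq v0 => v10; apply/matrixP=> i j; rewrite ord1 mxE.
    by elim/forall_ord2: i.
  exists (w 1 0 / v 1 0); apply/matrixP=> i j; rewrite ord1 mxE.
  elim/forall_ord2: i; last by rewrite divfK.
  by move/esym/eqP: vw; rewrite v00 mul0r mulr0 mulf_eq0 (negPf v10) => /eqP.
- exists (w 0 0 / v 0 0); apply/matrixP=> i j; rewrite ord1 mxE.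
  elim/forall_ord2: i; first by rewrite divfK.
  by apply: (mulfI v00); rewrite vw; field.
Qed.

Lemma scalar_mx2 M :
  [/\ M 0 0 - M 1 1 = 0, M 0 1 = 0 & M 1 0 = 0] -> M = (M 0 0)%:M.
Proof.
case=> /eqP; rewrite subr_eq0 => /eqP Md M01 M10.
apply/matrixP=> i j; rewrite !mxE.
by elim/forall_ord2: i; elim/forall_ord2: j.
Qed.

(** Commutation says that the vectors formed by the diagonal difference and the two off-diagonal
    entries of [A] and of [M] have vanishing 2 by 2 minors. The vector of [M] is nonzero, so that of
    [A] is [b] times it, and [a] absorbs the remaining scalar part. *)
Lemma comm_nonscalar M A : ~~ is_scalar_mx M -> A *m M = M *m A ->
  exists a b, A = a%:M + b *: M.
Proof.
move=> Mns /matrixP AM.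
have := AM 0 0; have := AM 0 1; have := AM 1 0; rewrite !mulmx2E => e10 e01 e00.
have c1 : A 0 1 * M 1 0 = M 0 1 * A 1 0.
  by apply: (addrI (A 0 0 * M 0 0)); rewrite e00; ring.
have c2 : (A 0 0 - A 1 1) * M 0 1 = (M 0 0 - M 1 1) * A 0 1.
  apply: (addrI (A 0 1 * M 1 1 + M 0 1 * A 1 1)).
  by transitivity (A 0 0 * M 0 1 + A 0 1 * M 1 1); [ring | rewrite e01; ring].
have c3 : (A 0 0 - A 1 1) * M 1 0 = (M 0 0 - M 1 1) * A 1 0.
  apply: (addrI (A 1 1 * M 1 0 + A 1 0 * M 1 1)).
  by transitivity (A 1 0 * M 0 0 + A 1 1 * M 1 0); [rewrite e10; ring | ring].
suff [b [bd b01 b10]] : exists b, [/\ A 0 0 - A 1 1 = b * (M 0 0 - M 1 1),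
    A 0 1 = b * M 0 1 & A 1 0 = b * M 1 0].
  exists (A 0 0 - b * M 0 0), b; apply/matrixP=> i j; rewrite !mxE.
  elim/forall_ord2: i; elim/forall_ord2: j => /=; rewrite ?mulr1n ?mulr0n ?add0r//.
    by rewrite subrK.
  by rewrite -[LHS](subKr (A 0 0)) bd; ring.
have ratio (x y a b : K) : x != 0 -> a * y = x * b -> b = a / x * y.
  by move=> x0 axb; apply: (mulfI x0); rewrite -axb; field.
have [Md|Md] := eqVneq (M 0 0 - M 1 1) 0; last first.
  by exists ((A 0 0 - A 1 1) / (M 0 0 - M 1 1)); split; apply: ratio => //; apply: mulrC.
have [M01|M01] := eqVneq (M 0 1) 0; last first.
  exists (A 0 1 / M 0 1); split; apply: ratio => //; last exact: mulrC.
  by rewrite mulrC -c2 mulrC.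
have [M10|M10] := eqVneq (M 1 0) 0; last first.
  exists (A 1 0 / M 1 0); split; apply: ratio => //; last exact: mulrC.
    by rewrite mulrC -c3 mulrC.
  by rewrite mulrC -c1 mulrC.
by case/negP: Mns; rewrite (scalar_mx2 (And3 Md M01 M10)) scalar_mx_is_scalar.
Qed.

(** The commutator kills a common eigenvector. *)
Lemma comm_det_common_eigenvector A B v (a b : K) :
  v != 0 -> A *m v = a *: v -> B *m v = b *: v -> comm_det A B = 0.
Proof.
move=> v0 Av Bv; apply/eqP/negPn/negP => det0; move/eqP: v0; apply.
have unitC : A *m B - B *m A \in unitmx by rewrite unitmxE unitfE.
apply: (can_inj (mulKmx unitC)); rewrite mulmx0 mulmxBl -!mulmxA Bv Av.
by rewrite -!scalemxAr Av Bv !scalerA mulrC subrr.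
Qed.

(** If [M] were not scalar, [A] and [B] would both be polynomials in [M] and so commute. *)
Lemma comm_det_neq0_scalar A B M : comm_det A B != 0 ->
  A *m M = M *m A -> B *m M = M *m B -> is_scalar_mx M.
Proof.
move=> AB AM BM; apply: contraNT AB => Mns.
have [a [b ->]] := comm_nonscalar Mns AM; have [c [d ->]] := comm_nonscalar Mns BM.
rewrite /comm_det; apply/eqP.
have -> : (a%:M + b *: M) *m (c%:M + d *: M) = (c%:M + d *: M) *m (a%:M + b *: M).
  rewrite !(mulmxDl, mulmxDr) -!scalar_mxM !mul_scalar_mx !mul_mx_scalar.
  by rewrite -!scalemxAl -!scalemxAr !scalerA addrACA [c * a]mulrC [c * b]mulrC
     [a * d]mulrC [d * b]mulrC -!addrA; congr (_ + _); rewrite addrCA.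
by rewrite subrr det0.
Qed.

End CommutingMatrices.

Section CommonEigenvector.
Variable K : closedFieldType.
Implicit Types (A B : 'M[K]_2).

Lemma exists_eigenvector A : exists2 v : 'cV[K]_2, v != 0 & exists a, A *m v = a *: v.
Proof.
have [A10|A10] := eqVneq (A 1 0) 0.
  exists (delta_mx 0 0).
    by apply/eqP => /matrixP/(_ 0 0)/eqP; rewrite !mxE oner_eq0.
  exists (A 0 0); apply/matrixP=> i j; rewrite ord1 mulmx2E !mxE /=.
  by elim/forall_ord2: i; rewrite ?A10/=; ring.
(* The vector (x, 1) is an eigenvector when A10 x^2 = (A00 - A11) x + A01; the coefficients below
   are those of this equation divided by A10. *)
have [x xE] := @solve_monicpoly K 2%N
  (fun i => if i == 0%N then A 0 1 / A 1 0 else (A 0 0 - A 1 1) / A 1 0) isT.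
rewrite sum_ord2 /= in xE.
have v1 : (\col_(i < 2) if i == 0 then x else 1) != 0 :> 'cV[K]_2.
  by apply/eqP => /matrixP/(_ 1 0)/eqP; rewrite !mxE oner_eq0.
exists (\col_(i < 2) if i == 0 then x else 1) => //.
apply: parallel2 => //; rewrite !mulmx2E !mxE /=.
apply/eqP; rewrite -subr_eq0; apply/eqP.
transitivity (A 1 0 *
    (x ^+ 2 - (A 0 1 / A 1 0 * x ^+ 0 + (A 0 0 - A 1 1) / A 1 0 * x ^+ 1))).
  by field.
by rewrite xE subrr mulr0.
Qed.

(** If [A] and [B] do not commute, a nonzero column of the commutator serves. If they commute,
    either [A] is scalar and any eigenvector of [B] serves, or [B] is a polynomial in [A] and shares
    its eigenvectors. *)
Lemma comm_det_eq0_common_eigenvector A B : comm_det A B = 0 ->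
  exists2 v : 'cV[K]_2, v != 0 & exists a b, A *m v = a *: v /\ B *m v = b *: v.
Proof.
move=> AB; have [/eqP|] := eqVneq (A *m B - B *m A) 0; last first.
  move=> C0; have [j Cj0] : exists j, col j (A *m B - B *m A) != 0.
    apply/existsP; rewrite -negb_forall; apply: contra C0 => /forallP C0.
    apply/eqP/matrixP=> i j; have /eqP/matrixP/(_ i 0) := C0 j.
    by rewrite [LHS]mxE => ->; rewrite !mxE.
  (* The commutator C has rank one and squares to 0, so its image is its kernel;
     this line is stable under A and B because tr (C A) = tr (C B) = 0. *)
  exists (col j (A *m B - B *m A)) => //.
  have eigC X : X = A \/ X = B ->
    exists a, X *m col j (A *m B - B *m A) = a *: col j (A *m B - B *m A).
    move=> XAB; apply: parallel2 => //; apply/eqP; rewrite -subr_eq0; apply/eqP.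
    (* With C the commutator and v its column, tr C = tr (C X) = 0 reduces the determinant of v and
       X v to an entry of [X] times det C, up to sign. *)
    transitivity ((if j == 0 then - X 1 0 else X 0 1) * comm_det A B); last first.
      by rewrite AB mulr0.
    rewrite /comm_det det2 !mulmx2E !mxE !sum_ord2.
    elim/forall_ord2: j {Cj0}; case: XAB => -> /=; ring.
  have [a Aa] := eigC A (or_introl erefl); have [b Bb] := eigC B (or_intror erefl).
  by exists a, b.
rewrite subr_eq0 => /eqP comAB.
have [|Ans] := boolP (is_scalar_mx A).
  case/is_scalar_mxP=> a ->; have [v v0 [b Bv]] := exists_eigenvector B.
  by exists v => //; exists a, b; rewrite mul_scalar_mx.
have [c [d ->]] := comm_nonscalar Ans (esym comAB).
have [v v0 [a Av]] := exists_eigenvector A.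
exists v => //; exists a, (c + d * a); split => //.
by rewrite mulmxDl mul_scalar_mx -scalemxAl Av scalerA scalerDl.
Qed.

End CommonEigenvector.

Section GoodRepresentations.
Variables (F : groupType) (g1 g2 : F).

Lemma irreducible_rep_comm_det (K : fieldType) (rho : {multiplicative F -> SL2 K}) :
  comm_det (slmx (rho g1)) (slmx (rho g2)) != 0 -> irreducible_rep rho.
Proof.
move=> /eqP det0 [v v0 rhov]; apply: det0.
have [|a Av] := rhov (rho g1); first by exists g1.
have [|b Bv] := rhov (rho g2); first by exists g2.
exact: comm_det_common_eigenvector v0 Av Bv.
Qed.

Lemma good_comm_det (K : fieldType) (rho : {multiplicative F -> SL2 K}) :
  comm_det (slmx (rho g1)) (slmx (rho g2)) != 0 -> good rho.
Proof.
move=> det0; split; first exact: irreducible_rep_comm_det det0.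
apply/seteqP; split => M /= comM; last by move=> x; apply: comM.
have scM : is_scalar_mx (slmx M).
  by apply: comm_det_neq0_scalar det0 _ _;
    have := congr1 (@slmx K) (esym (comM _)); apply.
move=> B; apply: val_inj => /=; have /is_scalar_mxP[m ->] := scM.
by rewrite mul_scalar_mx mul_mx_scalar.
Qed.

(** A common eigenvector of the images of the generators spans a line whose stabilizer pulls back to
    a subgroup containing [g1] and [g2], hence to all of [F]. *)
Lemma comm_det_irreducible_rep (K : closedFieldType) (rho : {multiplicative F -> SL2 K}) :
  free_on2 g1 g2 -> irreducible_rep rho ->
  comm_det (slmx (rho g1)) (slmx (rho g2)) != 0.
Proof.
move=> freeF irr; apply/eqP => /comm_det_eq0_common_eigenvector[v v0 [a [b [Av Bv]]]].
apply: irr; exists v => //.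
pose S : {pred F} := fun x => `[< parabolic v (rho x) >].
have closedS : group_closed S.
  split=> [|x y /asboolP[c cv] /asboolP[d dv]]; apply/asboolP.
    by exists 1; rewrite slmx_rep1 mul1mx scale1r.
  have unit_y := SL2_unit (rho y).
  (* Closure is tested on x y^-1, so the eigenvalue of [rho y] has to be inverted. *)
  have d0 : d != 0.
    apply: contra_neq v0 => d0; apply: (can_inj (mulKmx unit_y)).
    by rewrite dv d0 scale0r mulmx0.
  exists (c / d); rewrite slmx_repM slmx_repV -mulmxA.
  have -> : invmx (slmx (rho y)) *m v = d^-1 *: v.
    apply: (can_inj (mulKmx unit_y)).
    by rewrite mulKVmx// -scalemxAr dv scalerA mulVf ?scale1r.
  by rewrite -scalemxAr cv scalerA mulrC.
have SF := free_on2_ind closedS freeF.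
by move=> _ [x _ <-]; apply/asboolP; apply: SF; apply/asboolP; [exists a | exists b].
Qed.

End GoodRepresentations.

(** * Differentiation at 0 of complex and matrix valued paths *)

Section Derive.
Variable R : realType.
Local Notation C := R[i].
Implicit Types (f g : R -> C) (u v : C).

Lemma derive_at0_ext f g v : f =1 g -> derive_at0 f v -> derive_at0 g v.
Proof. by move=> /funext ->. Qed.

Lemma derive_at0_unique f u v : derive_at0 f u -> derive_at0 f v -> u = v.
Proof.
move=> [fr fi] [gr gi]; apply/eqP; rewrite eq_complex; apply/andP; split.
  by rewrite -(@derive_val _ _ _ _ _ _ _ fr) (@derive_val _ _ _ _ _ _ _ gr).
by rewrite -(@derive_val _ _ _ _ _ _ _ fi) (@derive_val _ _ _ _ _ _ _ gi).
Qed.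

Lemma derive_at0_cst u : derive_at0 (fun=> u) 0.
Proof. by split; apply: is_derive_cst. Qed.

Lemma derive_at0_id : derive_at0 (fun s : R => s%:C) 1.
Proof. by split; [apply: is_derive_id | apply: is_derive_cst]. Qed.

Lemma derive_at0D f g u v :
  derive_at0 f u -> derive_at0 g v -> derive_at0 (fun s => f s + g s) (u + v).
Proof.
move=> [fr fi] [gr gi].
have -> : (fun s => f s + g s) = (fun s =>
    (complex.Re (f s) + complex.Re (g s)) +i* (complex.Im (f s) + complex.Im (g s))).
  by apply: funext => s; case: (f s) (g s) => [? ?] [? ?].
by case: u v fr fi gr gi => [? ?] [? ?] /= *; split=> /=; apply: is_deriveD.
Qed.

Lemma derive_at0M f g u v : derive_at0 f u -> derive_at0 g v ->
  derive_at0 (fun s => f s * g s) (u * g 0 + f 0 * v).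
Proof.
move=> [fr fi] [gr gi]; split.
  have -> : (fun s => complex.Re (f s * g s)) =
      (fun s => complex.Re (f s)) * (fun s => complex.Re (g s))
      - (fun s => complex.Im (f s)) * (fun s => complex.Im (g s)).
    by apply: funext => s; rewrite !fctE; case: (f s) (g s) => [? ?] [? ?].
  apply: is_derive_eq.
  rewrite /GRing.scale /=.
  by case: (f 0) (g 0) u v {fr fi gr gi} => [? ?] [? ?] [? ?] [? ?] /=; ring.
have -> : (fun s => complex.Im (f s * g s)) =
    (fun s => complex.Re (f s)) * (fun s => complex.Im (g s))
    + (fun s => complex.Im (f s)) * (fun s => complex.Re (g s)).
  by apply: funext => s; rewrite !fctE; case: (f s) (g s) => [? ?] [? ?].
apply: is_derive_eq.
rewrite /GRing.scale /=.
by case: (f 0) (g 0) u v {fr fi gr gi} => [? ?] [? ?] [? ?] [? ?] /=; ring.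
Qed.

Lemma derive_at0_sum (I : Type) (r : seq I) (f : I -> R -> C) (v : I -> C) :
  (forall i, derive_at0 (f i) (v i)) ->
  derive_at0 (fun s => \sum_(i <- r) f i s) (\sum_(i <- r) v i).
Proof.
move=> fv; elim: r => [|i r IH].
  by rewrite big_nil; apply: derive_at0_ext (derive_at0_cst 0) => s; rewrite big_nil.
rewrite big_cons; apply: derive_at0_ext (derive_at0D (fv i) IH) => s.
by rewrite big_cons.
Qed.

(** The real or the imaginary part is nonzero at 0; being differentiable there, it is continuous and
    stays nonzero nearby. *)
Lemma derive_at0_neq0 f v :
  derive_at0 f v -> f 0 != 0 -> \forall s \near (0 : R), f s != 0.
Proof.
have neq0 (g : R -> R) d : is_derive (0 : R) (1 : R) g d -> g 0 != 0 ->
    \forall s \near (0 : R), g s != 0.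
  move=> gd g0.
  have /derivable1_diffP/differentiable_continuous cg := @ex_derive _ _ _ _ _ _ _ gd.
  exact: (@cvgr_neq0 R R _ (nbhs (0 : R)) _ g (g 0) cg g0).
move=> [fr fi]; rewrite eq_complex negb_and => /orP[] f0.
  by apply: filterS (neq0 _ _ fr f0) => s; rewrite eq_complex => /negPf ->.
by apply: filterS (neq0 _ _ fi f0) => s; rewrite eq_complex andbC => /negPf ->.
Qed.

Lemma mxderive_at0_cst (A : 'M[C]_2) : mxderive_at0 (fun=> A) 0.
Proof. by move=> i j; rewrite mxE; apply: derive_at0_cst. Qed.

Lemma mxderive_at0D (f g : R -> 'M[C]_2) (A B : 'M[C]_2) :
  mxderive_at0 f A -> mxderive_at0 g B -> mxderive_at0 (fun s => f s + g s) (A + B).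
Proof.
move=> fA gB i j; rewrite mxE.
by apply: derive_at0_ext (derive_at0D (fA i j) (gB i j)) => s; rewrite mxE.
Qed.

Lemma mxderive_at0M (f g : R -> 'M[C]_2) (A B : 'M[C]_2) :
  mxderive_at0 f A -> mxderive_at0 g B ->
  mxderive_at0 (fun s => f s *m g s) (A *m g 0 + f 0 *m B).
Proof.
move=> fA gB i j; rewrite !mxE -big_split /=.
apply: derive_at0_ext (derive_at0_sum _ (fun k => derive_at0M (fA i k) (gB k j))) => s.
by rewrite mxE.
Qed.

Lemma derive_at0_tr (f : R -> 'M[C]_2) (A : 'M[C]_2) :
  mxderive_at0 f A -> derive_at0 (fun s => \tr (f s)) (\tr A).
Proof. by move=> fA; apply: derive_at0_sum => i; apply: fA. Qed.

End Derive.

(** * The torsion form *)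

Section LinearFunctionals.
Variable K : fieldType.

Lemma memv_span_map (V W : vectType K) (f : {linear V -> W}) (X : seq V) v :
  v \in <<X>>%VS -> f v \in <<map f X>>%VS.
Proof.
move=> /(coord_span (X := in_tuple X)) ->; rewrite linear_sum.
apply: memv_suml => i _; rewrite linearZ memvZ// memv_span// map_f//.
by rewrite mem_nth.
Qed.

(** The matrix of values on [a] is the coordinate matrix times the matrix of values on [b]. *)
Lemma basis_change_functionals (V : vectType K) n (a b : n.-tuple V)
    (phi : 'I_n -> {scalar V}) :
  basis_of fullv b ->
  basis_change a b * \det (\matrix_(i < n, k < n) phi k (tnth b i)) =
  \det (\matrix_(i < n, k < n) phi k (tnth a i)).
Proof.
move=> basis_b; rewrite /basis_change -det_mulmx; congr (\det _).
apply/matrixP=> i k; rewrite !mxE [in RHS](coord_basis basis_b (memvf (tnth a i))).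
rewrite linear_sum; apply: eq_bigr => j _.
by rewrite !mxE linearZ /= -tnth_nth.
Qed.

End LinearFunctionals.

Section Torsion.
Variable K : fieldType.
Local Notation g := (subvs_of (sl2 K)).
Implicit Types (A B U W : 'M[K]_2) (X : g) (z : g * g) (c : 3.-tuple g).

Definition pairing (p : 'M[K]_2 * 'M[K]_2) z : K :=
  \tr (vsval z.1 *m p.1) + \tr (vsval z.2 *m p.2).

Fact pairing_scalar p : scalar (pairing p).
Proof.
move=> a y z; rewrite /pairing /= !mulmxDl !mxtraceD -!scalemxAl !mxtraceZ.
by rewrite mulrDr addrACA.
Qed.

HB.instance Definition _ p :=
  GRing.isLinear.Build K (g * g)%type K *%R (pairing p) (pairing_scalar p).

Definition in_fst X : g * g := (X, 0).
Definition in_snd X : g * g := (0, X).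

Fact in_fst_linear : linear in_fst.
Proof. by move=> a X Y; apply: congr2 => //=; rewrite scaler0 addr0. Qed.

Fact in_snd_linear : linear in_snd.
Proof. by move=> a X Y; apply: congr2 => //=; rewrite scaler0 addr0. Qed.

HB.instance Definition _ := GRing.isLinear.Build K g (g * g)%type *:%R in_fst in_fst_linear.
HB.instance Definition _ := GRing.isLinear.Build K g (g * g)%type *:%R in_snd in_snd_linear.

Lemma double_basis_basis c : basis_of fullv c -> basis_of fullv (double_basis c).
Proof.
move=> basis_c; rewrite basisEdim; apply/andP; split; last first.
  rewrite size_tuple dimvf; have := size_basis basis_c; rewrite dimvf => dimg.
  by rewrite [X in (_ <= X)%N](_ : _ = dim g + dim g)%N// dimg.
apply/subvP => -[X Y] _.
have -> : (X, Y) = in_fst X + in_snd Y by apply: congr2; rewrite /= ?addr0 ?add0r.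
have memc Z : Z \in <<c>>%VS by rewrite (span_basis basis_c) memvf.
rewrite /double_basis /= span_cat memv_add//.
  exact: (memv_span_map [the {linear g -> (g * g)%type} of in_fst] (memc X)).
exact: (memv_span_map [the {linear g -> (g * g)%type} of in_snd] (memc Y)).
Qed.

Lemma trace_sl2 X : vsval X 1 1 = - vsval X 0 0.
Proof.
have := subvsP X; rewrite mem_sl2 mxtrace2 addr_eq0 => /eqP ->.
by rewrite opprK.
Qed.

Definition volume c : K :=
  \det (\matrix_(i < 3, j < 3) tnth [tuple vsval (tnth c i) 0 0;
     vsval (tnth c i) 0 1; vsval (tnth c i) 1 0] j).

(* The trace pairing with [U] only depends on the trace-free part of [U]. *)
Definition covolume (U : 3.-tuple 'M[K]_2) : K :=
  \det (\matrix_(i < 3, j < 3) tnth [tuple tnth U j 0 0 - tnth U j 1 1;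
     tnth U j 1 0; tnth U j 0 1] i).

(** For trace-free X, tr (X U) = X00 (U00 - U11) + X01 U10 + X10 U01, so the matrix is a product. *)
Lemma det_trace_pairing c (U : 3.-tuple 'M[K]_2) :
  \det (\matrix_(i < 3, k < 3) \tr (vsval (tnth c i) *m tnth U k)) =
  volume c * covolume U.
Proof.
rewrite /volume /covolume -det_mulmx; congr (\det _); apply/matrixP=> i k.
by rewrite !mxE mxtrace2 !mulmx2E trace_sl2 sum_ord3 !mxE /tnth /=; ring.
Qed.

(** For trace-free matrices the diagonal difference is twice the first entry, and the off-diagonal
    entries come in the opposite order: hence the factors 2 and -1. *)
Lemma covolume_sl2 c : covolume (map_tuple vsval c) = - 2 * volume c.
Proof.
rewrite /covolume /volume !det3 !mxE !tnth_map !trace_sl2.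
move: (vsval (tnth c 0)) (vsval (tnth c 1)) (vsval (tnth c 2)) => X Y Z.
by rewrite /tnth /=; ring.
Qed.

(** The Gram matrix of the trace form is minus the identity, of determinant -1, and also factors as
    [volume c] times -2 [volume c]. *)
Lemma volume_orthonormal c : orthonormal_basis c -> 2 * volume c ^+ 2 = 1.
Proof.
move=> [_ c_on]; have := det_trace_pairing c (map_tuple vsval c).
rewrite covolume_sl2.
have -> : \matrix_(i < 3, k < 3) \tr (vsval (tnth c i) *m tnth (map_tuple vsval c) k)
    = -1 *: 1%:M.
  apply/matrixP=> i k; rewrite !mxE tnth_map mulN1r -c_on.
  by rewrite /formB opprK.
rewrite detZ det1 mulr1 -signr_odd /= expr1 => /(congr1 -%R).
by rewrite opprK => H; rewrite [RHS]H; ring.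
Qed.

Lemma covolumeE U V W : covolume [tuple U; V; W] =
  let u := U 0 0 - U 1 1 in let v := V 0 0 - V 1 1 in let w := W 0 0 - W 1 1 in
  u * (V 1 0 * W 0 1 - W 1 0 * V 0 1) - v * (U 1 0 * W 0 1 - W 1 0 * U 0 1)
  + w * (U 1 0 * V 0 1 - V 1 0 * U 0 1).
Proof. by rewrite /covolume det3 !mxE /tnth. Qed.

Lemma covolumeN U V W : covolume [tuple U; V; - W] = - covolume [tuple U; V; W].
Proof. by rewrite !covolumeE /= !mxE; ring. Qed.

(** This triple and the next one are the coefficients in the two diagonal blocks of the matrix of
    functionals on the basis of C^1. *)
Lemma covolume_B_AB_A A B : covolume [tuple B; A *m B; A] = comm_det A B.
Proof. by rewrite covolumeE /comm_det det2 !(mulmx2E, mxE) /=; ring. Qed.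

Lemma covolume_A_B_BA A B : covolume [tuple A; B; B *m A] = - comm_det A B.
Proof. by rewrite covolumeE /comm_det det2 !(mulmx2E, mxE) /=; ring. Qed.

(** For [A] and [B] of determinant 1 the factors tr A - A and tr B - B are inverses; the case of
    interest is C = BA - AB. *)
Lemma covolume_adj A B C : \tr C = 0 ->
  covolume [tuple ((\tr A)%:M - A) *m C; C; ((\tr B)%:M - B) *m C] =
  \det C * \tr (C *m (A *m B - B *m A)).
Proof.
rewrite mxtrace2 addrC => /eqP; rewrite addr_eq0 => /eqP C11.
rewrite covolumeE det2 !mxtrace2 !(mulmx2E, mxE) /= C11; ring.
Qed.

End Torsion.

Section Omega.
Variables (K : fieldType) (F : groupType) (g1 g2 : F).
Variable rho : {multiplicative F -> SL2 K}.
Local Notation g := (subvs_of (sl2 K)).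
Local Notation A := (slmx (rho g1)).
Local Notation B := (slmx (rho g2)).

(** Cyclicity of the trace moves the conjugation from [X] to the coefficients: M^-1 V M - V = M^-1
    (V M - M V). *)
Lemma pairing_delta U W X : pairing (U, W) (delta g1 g2 rho X) =
  \tr (vsval X *m (invmx A *m (U *m A - A *m U) + invmx B *m (W *m B - B *m W))).
Proof.
have conj_trace (M : SL2 K) V :
    \tr ((slmx M *m vsval X *m invmx (slmx M) - vsval X) *m V) =
    \tr (vsval X *m (invmx (slmx M) *m (V *m slmx M - slmx M *m V))).
  rewrite !mulmxBr !mulmxBl mulKmx ?SL2_unit// !linearB /=; congr (_ - _).
  by rewrite -!mulmxA mxtrace_mulC -!mulmxA.
by rewrite mulmxDr mxtraceD -!conj_trace.
Qed.

(* Through [pairing], these give [dt_1], [dt_2] and [dt_12]. *)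
Definition dt_coeffs : 3.-tuple ('M[K]_2 * 'M[K]_2) :=
  [tuple (A, 0); (0, B); (A *m B, B *m A)].

Definition transverse_coeffs : 3.-tuple ('M[K]_2 * 'M[K]_2) :=
  [tuple (B, 0); (A *m B, 0); (0, A)].

(** This is the infinitesimal form of conjugation invariance of traces. The first two coefficients
    give zero commutators; for (AB, BA) the contributions BA - AB and AB - BA cancel. *)
Lemma dt_delta i X : pairing (tnth dt_coeffs i) (delta g1 g2 rho X) = 0.
Proof.
rewrite (tnth_nth 0) /=; case: i => [[|[|[|//]]] ?] /=;
  rewrite pairing_delta ?mul0mx ?mulmx0 ?subrr ?mulmx0 ?addr0 ?mulmx0 ?mxtrace0//.
have conjK (M N : SL2 K) :
    invmx (slmx M) *m (slmx M *m slmx N *m slmx M - slmx M *m (slmx M *m slmx N)) =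
    slmx N *m slmx M - slmx M *m slmx N.
  by rewrite mulmxBr -mulmxA !mulKmx ?SL2_unit.
by rewrite !conjK addrC subrKA subrr mulmx0 mxtrace0.
Qed.

(** These are the matrices that [pairing_delta] produces from [transverse_coeffs]. With C = BA - AB
    the covolume is det C times tr (C^2), and C^2 = - det C by Cayley-Hamilton. *)
Lemma covolume_delta : covolume [tuple invmx A *m (B *m A - A *m B);
   B *m A - A *m B; invmx B *m (A *m B - B *m A)] = - 2 * comm_det A B ^+ 2.
Proof.
have trC : \tr (B *m A - A *m B) = 0 by rewrite linearB /= mxtrace_mulC subrr.
rewrite -[A *m B - B *m A]opprB mulmxN covolumeN !invmx_SL2 covolume_adj//.
rewrite -[A *m B - B *m A]opprB mulmxN linearN /= sqmx2 trC scale0r sub0r linearN /=.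
have -> : \det (B *m A - A *m B) = comm_det A B.
  by rewrite /comm_det !det2 !mxE; ring.
by rewrite mxtrace_scalar; ring.
Qed.

Variable c : 3.-tuple g.

Lemma det_functionals_delta (h : 3.-tuple (g * g)%type) :
  \det (\matrix_(i < 3 + 3, k < 3 + 3)
      pairing (tnth [tuple of transverse_coeffs ++ dt_coeffs] k)
      (tnth [tuple of map (delta g1 g2 rho) c ++ h] i)) =
  - 2 * comm_det A B ^+ 2 * volume c *
  \det (\matrix_(i < 3, k < 3) pairing (tnth dt_coeffs k) (tnth h i)).
Proof.
rewrite [\matrix_(i < 3 + 3, k < 3 + 3) _](_ : _ = block_mx
   (\matrix_(i < 3, k < 3) pairing (tnth transverse_coeffs k) (delta g1 g2 rho (tnth c i))) 0
   (\matrix_(i < 3, k < 3) pairing (tnth transverse_coeffs k) (tnth h i))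
   (\matrix_(i < 3, k < 3) pairing (tnth dt_coeffs k) (tnth h i))).
  rewrite det_lblock -covolume_delta; congr (_ * _).
  rewrite mulrC -det_trace_pairing; congr (\det _); apply/matrixP=> i k; rewrite !mxE.
  rewrite !(tnth_nth 0); case: k => [[|[|[|//]]] ?] /=;
    rewrite pairing_delta ?mul0mx ?mulmx0 ?subrr ?mulmx0 ?addr0 ?add0r//.
  by rewrite mulmxBr -mulmxA !mulKmx ?SL2_unit.
apply/matrixP=> i k; rewrite mxE.
case: (split_ordP i) => i' ->; case: (split_ordP k) => k' ->;
 rewrite ?block_mxEul ?block_mxEur ?block_mxEdl ?block_mxEdr !mxE
   ?tnth_lshift ?tnth_rshift ?tnth_map//.
by rewrite dt_delta.
Qed.

(** After a swap of two columns the matrix is block triangular. The blocks contribute [comm_det A B]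
    and its opposite, and the sign of the swap restores the plus. *)
Lemma det_functionals_basis :
  \det (\matrix_(i < 3 + 3, k < 3 + 3)
      pairing (tnth [tuple of transverse_coeffs ++ dt_coeffs] k)
      (tnth (double_basis c) i)) = comm_det A B ^+ 2 * volume c ^+ 2.
Proof.
(* Swapping [(0, A)] and [(A, 0)] puts the functionals of [z_1] first. *)
pose s : 'S_(3 + 3) := tperm (lshift 3 2) (rshift 3 0).
pose U := [tuple B; A *m B; A]; pose W := [tuple A; B; B *m A].
set N := \matrix_(i, k) _.
have : col_perm s N = block_mx
   (\matrix_(i < 3, k < 3) \tr (vsval (tnth c i) *m tnth U k))
   (\matrix_(i < 3, k < 3) \tr (vsval (tnth c i) *m tnth [tuple 0; 0; A *m B] k)) 0
   (\matrix_(i < 3, k < 3) \tr (vsval (tnth c i) *m tnth W k)).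
  apply/matrixP=> i k; rewrite [LHS]mxE [LHS]mxE.
  case: (split_ordP i) => i' ->; case: (split_ordP k) => k' ->;
   rewrite ?block_mxEul ?block_mxEur ?block_mxEdl ?block_mxEdr !mxE /double_basis
   ?tnth_lshift ?tnth_rshift ?tnth_map permE; case: k' => [[|[|[|//]]] ?];
   rewrite !(tnth_nth 0) /pairing /= ?mul0mx ?mulmx0 ?mxtrace0 ?addr0 ?add0r//.
move/(congr1 determinant); rewrite det_ublock !det_trace_pairing covolume_B_AB_A covolume_A_B_BA.
rewrite col_permE det_mulmx det_perm odd_permV odd_tperm /= expr1 => H.
apply: oppr_inj; rewrite -[LHS]mulrN1 H; ring.
Qed.

(** Dividing -2 k^2 v by k^2 v^2, with k the commutator determinant and v the volume, leaves -2 / v,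
    which is -4 v since 2 v^2 = 1. *)
Lemma Omega_dt (h : 3.-tuple (g * g)%type) :
  orthonormal_basis c -> comm_det A B != 0 ->
  Omega g1 g2 c rho h = - 4 * volume c *
  \det (\matrix_(i < 3, k < 3) pairing (tnth dt_coeffs k) (tnth h i)).
Proof.
move=> c_on AB; have vol := volume_orthonormal c_on.
have := @basis_change_functionals K _ _ [tuple of map (delta g1 g2 rho) c ++ h] _
  (fun k => pairing (tnth [tuple of transverse_coeffs ++ dt_coeffs] k))
  (double_basis_basis c_on.1).
rewrite det_functionals_basis det_functionals_delta -/(Omega _ _ _ _ _) => H.
have v0 : comm_det A B ^+ 2 * volume c ^+ 2 != 0.
  rewrite mulf_neq0// expf_neq0//; apply/eqP=> v0.
  by move/eqP: vol; rewrite v0 expr0n mulr0 eq_sym oner_eq0.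
apply: (mulIf v0); rewrite H.
transitivity (- 2 * comm_det A B ^+ 2 * volume c *
   \det (\matrix_(i < 3, k < 3) pairing (tnth dt_coeffs k) (tnth h i)) * (2 * volume c ^+ 2)).
  by rewrite vol mulr1.
by ring.
Qed.

End Omega.

(** * The differentials of the traces *)

Section UnipotentCurves.
Variable K : fieldType.

Lemma unipotent_exists (N : 'M[K]_2) (t : K) : \tr N = 0 -> \det N = 0 ->
  exists A : SL2 K, slmx A = 1%:M + t *: N.
Proof.
move=> trN detN; have det1 : \det (1%:M + t *: N) == 1.
  apply/eqP; transitivity (1 + t * \tr N + t ^+ 2 * \det N).
    by rewrite !det2 mxtrace2 !mxE /=; ring.
  by rewrite trN detN !mulr0 !addr0.
by exists (MkSL2 det1).
Qed.

(** Trace and determinant 0 mean nilpotent, and a nilpotent N is tangent to the curve 1 + t N in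
    SL_2; so sums of nilpotents are reached by products of such curves. *)
Lemma sl2_nilpotent_sum (X : 'M[K]_2) : \tr X = 0 ->
  exists N1 N2 N3, [/\ X = N1 + N2 + N3, (\tr N1 = 0 /\ \det N1 = 0),
    (\tr N2 = 0 /\ \det N2 = 0) & (\tr N3 = 0 /\ \det N3 = 0)].
Proof.
rewrite mxtrace2 addrC => /eqP; rewrite addr_eq0 => /eqP X11.
(* diag(1, -1) = [[1, -1], [1, -1]] + [[0, 1], [0, 0]] - [[0, 0], [1, 0]] *)
exists (X 0 0 *: \matrix_(i < 2, j < 2) (if j == 0 then 1 else -1)).
exists ((X 0 1 + X 0 0) *: delta_mx 0 1), ((X 1 0 - X 0 0) *: delta_mx 1 0).
rewrite !mxtrace2 !det2 !mxE /=; split; try split; try ring.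
apply/matrixP; elim/forall_ord2; elim/forall_ord2; rewrite !mxE /= ?X11; ring.
Qed.

End UnipotentCurves.

Section Paths.
Variable R : realType.
Local Notation C := R[i].

Lemma mxderive_at0_ext (f g : R -> 'M[C]_2) (D : 'M[C]_2) :
  f =1 g -> mxderive_at0 f D -> mxderive_at0 g D.
Proof. by move=> /funext ->. Qed.

Lemma mxderive_at0_unipotent (N : 'M[C]_2) :
  mxderive_at0 (fun s : R => 1%:M + s%:C *: N) N.
Proof.
move=> i j; have := derive_at0D (derive_at0_cst (1%:M i j : C))
  (derive_at0M (derive_at0_id R) (derive_at0_cst (N i j))).
rewrite mulr0 addr0 mul1r add0r; apply: derive_at0_ext => s.
by rewrite !mxE.
Qed.

Lemma SL2_curve (X : subvs_of (sl2 C)) : exists U : R -> SL2 C,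
  U 0 = 1%g /\ mxderive_at0 (fun s => slmx (U s)) (vsval X).
Proof.
have := subvsP X; rewrite mem_sl2 => /eqP /sl2_nilpotent_sum.
case=> N1 [N2 [N3 [-> [tr1 det1] [tr2 det2] [tr3 det3]]]].
have /choice[U1 U1E] := fun s : R => unipotent_exists s%:C tr1 det1.
have /choice[U2 U2E] := fun s : R => unipotent_exists s%:C tr2 det2.
have /choice[U3 U3E] := fun s : R => unipotent_exists s%:C tr3 det3.
exists (fun s => (U1 s * U2 s * U3 s)%g); split.
  by apply: val_inj => /=; rewrite U1E U2E U3E !scale0r !addr0 !mul1mx.
have dU (N : 'M[C]_2) (U : R -> SL2 C) :
    (forall s, slmx (U s) = 1%:M + s%:C *: N) -> mxderive_at0 (fun s => slmx (U s)) N.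
  by move=> UE; apply: mxderive_at0_ext (mxderive_at0_unipotent N) => s; rewrite UE.
have := mxderive_at0M (mxderive_at0M (dU _ _ U1E) (dU _ _ U2E)) (dU _ _ U3E).
by rewrite U1E U2E U3E !scale0r !addr0 !mulmx1 !mul1mx.
Qed.

Lemma derive_at0_comm_det (f g : R -> 'M[C]_2) (A B : 'M[C]_2) :
  mxderive_at0 f A -> mxderive_at0 g B ->
  exists v, derive_at0 (fun s => comm_det (f s) (g s)) v.
Proof.
move=> fA gB; have dfg := mxderive_at0M fA gB; have dgf := mxderive_at0M gB fA.
(* Subtraction is written as multiplication by a constant, so that the sum and product rules
   suffice. *)
have dC := mxderive_at0D dfg (mxderive_at0M (mxderive_at0_cst (-1)%:M) dgf).
have d1 := derive_at0M (dC 0 0) (dC 1 1).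
have d2 := derive_at0M (dC 0 1) (dC 1 0).
have := derive_at0D d1 (derive_at0M (derive_at0_cst (-1)) d2).
set v := (X in derive_at0 _ X) => dv; exists v; apply: derive_at0_ext dv => s.
rewrite /comm_det det2; have -> : (-1)%:M *m (g s *m f s) = - (g s *m f s).
  by rewrite mul_scalar_mx scaleN1r.
by rewrite mulN1r.
Qed.

Variables (F : groupType) (g1 g2 : F).
Hypothesis freeF : free_on2 g1 g2.
Local Notation rep := {multiplicative F -> SL2 C}.

(** Each generator is moved along a curve in SL_2 with the prescribed tangent, and freeness extends
    the moved pair to a representation for each [s]. *)
Lemma good_path_exists (rho : rep) z : good rho ->
  exists rho_ : R -> rep, path_with_tangent g1 g2 rho rho_ z.
Proof.
move=> [irr _]; have [U1 [U10 dU1]] := SL2_curve z.1; have [U2 [U20 dU2]] := SL2_curve z.2.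
have [exF uniqF] := freeF (SL2 C).
have /choice[r rE] := fun s => exF (U1 s * rho g1)%g (U2 s * rho g2)%g.
exists r; split.
- by apply: uniqF; have [r1 r2] := rE 0; rewrite ?r1 ?r2 ?U10 ?U20 mul1g.
- have d1 := mxderive_at0M dU1 (mxderive_at0_cst (slmx (rho g1))).
  have d2 := mxderive_at0M dU2 (mxderive_at0_cst (slmx (rho g2))).
  have [v dv] := derive_at0_comm_det d1 d2.
  (* Goodness persists near 0 because the commutator determinant is nonzero at 0. *)
  apply: filterS (derive_at0_neq0 dv _) => [s|] /=.
    by move=> det0; apply: (@good_comm_det _ g1 g2); have [-> ->] := rE s.
  by rewrite U10 U20 !mul1mx; apply: comm_det_irreducible_rep.
- by have -> : (fun s => slmx (r s g1 * (rho g1)^-1)%g) = (fun s => slmx (U1 s));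
    [apply: funext => s; have [-> _] := rE s; rewrite mulgK | ].
- by have -> : (fun s => slmx (r s g2 * (rho g2)^-1)%g) = (fun s => slmx (U2 s));
    [apply: funext => s; have [_ ->] := rE s; rewrite mulgK | ].
Qed.

Lemma path_trace_derivatives (rho : rep) (rho_ : R -> rep) w :
  path_with_tangent g1 g2 rho rho_ w ->
  let A := slmx (rho g1) in let B := slmx (rho g2) in
  [/\ derive_at0 (trace_fun g1 \o rho_) (\tr (vsval w.1 *m A)),
      derive_at0 (trace_fun g2 \o rho_) (\tr (vsval w.2 *m B)) &
      derive_at0 (trace_fun (g1 * g2)%g \o rho_)
        (\tr (vsval w.1 *m (A *m B)) + \tr (vsval w.2 *m (B *m A)))].
Proof.
move=> [rho0 _ d1 d2] A B.
have E x s : slmx (rho_ s x) = slmx (rho_ s x * (rho x)^-1)%g *m slmx (rho x).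
  by rewrite /= mulmxKV ?SL2_unit.
have dE x (X : 'M[C]_2) : mxderive_at0 (fun s => slmx (rho_ s x * (rho x)^-1)%g) X ->
    mxderive_at0 (fun s => slmx (rho_ s x)) (X *m slmx (rho x)).
  move=> dX; have := mxderive_at0M dX (mxderive_at0_cst (slmx (rho x))).
  by rewrite mulmx0 addr0 -(funext (E x)).
split; [exact: derive_at0_tr (dE _ _ d1) | exact: derive_at0_tr (dE _ _ d2) |].
have := derive_at0_tr (mxderive_at0M (dE _ _ d1) (dE _ _ d2)).
(* The product rule gives z_1 A B + A z_2 B, and the trace of the second term is that of z_2 B A. *)
rewrite !rho0 -/A -/B mxtraceD -!mulmxA [\tr (A *m _)]mxtrace_mulC -!mulmxA.
by apply: derive_at0_ext => s; rewrite /= /trace_fun slmx_repM.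
Qed.

(** The value selected by [xget] is [L z]: it is attained, since some good path has tangent [z], and
    it is the only candidate, since every admissible path has derivative [L w] with [w] cohomologous
    to [z]. *)
Lemma diff_at_path (f : rep -> C) (L : subvs_of (sl2 C) * subvs_of (sl2 C) -> C)
    (rho : rep) z :
  good rho ->
  (forall w, cohomologous g1 g2 rho w z -> L w = L z) ->
  (forall rho_ w, path_with_tangent g1 g2 rho rho_ w -> derive_at0 (f \o rho_) (L w)) ->
  diff_at g1 g2 f rho z = L z.
Proof.
move=> rho_good Lz fL; have [rho_ path_z] := good_path_exists z rho_good.
apply: xget_unique => [|v [r [w [path_w /Lz <- /derive_at0_unique]]]]; last first.
  by apply; apply: fL.
exists rho_, z; split => //; last exact: fL.
exists 0; rewrite subrr /delta.
by congr (_, _); apply: val_inj; rewrite /= subr0 mulmx0 mul0mx.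
Qed.

End Paths.

Section DifferentialOfTraces.
Variables (R : realType) (F : groupType) (g1 g2 : F).
Hypothesis freeF : free_on2 g1 g2.
Local Notation C := R[i].
Variable rho : {multiplicative F -> SL2 C}.
Hypothesis rho_good : good rho.

Lemma wedge3_trace_funs (h : 3.-tuple (subvs_of (sl2 C) * subvs_of (sl2 C))%type) :
  wedge3 (diff_at g1 g2 (trace_fun g1) rho) (diff_at g1 g2 (trace_fun g2) rho)
    (diff_at g1 g2 (trace_fun (g1 * g2)%g) rho) h =
  \det (\matrix_(i < 3, k < 3) pairing (tnth (dt_coeffs g1 g2 rho) k) (tnth h i)).
Proof.
(* In [wedge3] the functionals index the rows, in the matrix of pairings the columns. *)
rewrite -det_tr; congr (\det _); apply/matrixP=> i j; rewrite !mxE.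
have inv k w z : cohomologous g1 g2 rho w z ->
    pairing (tnth (dt_coeffs g1 g2 rho) k) w = pairing (tnth (dt_coeffs g1 g2 rho) k) z.
  move=> [X wz]; apply/eqP; rewrite -subr_eq0 -linearB /= wz.
  by apply/eqP; apply: dt_delta.
have := fun w => inv i w (tnth h j); move: (tnth h j) => z.
rewrite !(tnth_nth (0, 0)) !(tnth_nth (fun=> 0)).
case: i => [[|[|[|//]]] ?] /= Lz.
- apply: (diff_at_path freeF rho_good Lz) => r w /path_trace_derivatives[d _ _].
  by rewrite /pairing /= mulmx0 mxtrace0 addr0.
- apply: (diff_at_path freeF rho_good Lz) => r w /path_trace_derivatives[_ d _].
  by rewrite /pairing /= mulmx0 mxtrace0 add0r.
- by apply: (diff_at_path freeF rho_good Lz) => r w /path_trace_derivatives[].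
Qed.

End DifferentialOfTraces.

(** * The constant and its sign *)

Unset Implicit Arguments.

Theorem corollary38 (R : realType) (F2 : groupType) (g1 g2 : F2)
    (freeF2 : free_on2 g1 g2)
    (c0 : 3.-tuple (subvs_of (sl2 R[i]))) (c0_on : orthonormal_basis c0) :
  exists b : bool,
    forall (rho : {multiplicative F2 -> SL2 R[i]}) (rho_good : good rho)
      (h : 3.-tuple (subvs_of (sl2 R[i]) * subvs_of (sl2 R[i]))%type)
      (h_basis : H1_basis g1 g2 rho h),
      Omega g1 g2 c0 rho h =
        (-1) ^+ b * (2 * Num.sqrt 2 : R)%:C *
        wedge3 (diff_at g1 g2 (trace_fun g1) rho)
               (diff_at g1 g2 (trace_fun g2) rho)
               (diff_at g1 g2 (trace_fun (g1 * g2)%g) rho) h.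
Proof.
have vol := volume_orthonormal c0_on.
pose r : R[i] := (Num.sqrt 2 : R)%:C.
have r2 : r ^+ 2 = 2 by rewrite -rmorphXn /= sqr_sqrtr ?ler0n// rmorph_nat.
(* As 2 v^2 = 1, the number v sqrt 2 is 1 or -1, and -4 v = -(v sqrt 2)(2 sqrt 2). *)
have vol4 : exists b : bool, - 4 * volume c0 = (-1) ^+ b * (2 * r).
  have /eqP : (volume c0 * r) ^+ 2 = 1 by rewrite exprMn r2 mulrC.
  have -> : - 4 * volume c0 = - (volume c0 * r) * (2 * r).
    transitivity (- 2 * volume c0 * r ^+ 2); last by ring.
    by rewrite r2; ring.
  rewrite sqrf_eq1 => /orP[] /eqP ->; [exists true | exists false].
    by rewrite expr1.
  by rewrite opprK.
(* The sign comes from [c0] alone, so it is fixed before [rho] and [h]. *)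
have [b bE] := vol4; exists b => rho rho_good h _.
have det0 := comm_det_irreducible_rep freeF2 rho_good.1.
rewrite (Omega_dt _ c0_on det0) bE (wedge3_trace_funs freeF2 rho_good).
by rewrite rmorphM rmorph_nat.
Qed.
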